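(* Under the All-Edges Sparse Triangle Hypothesis, any algorithm that achieves approximation ratio better than $3/2$ for All-Nodes Shortest Cycles on unweighted undirected graphs with $m$ edges requires $m^{4/3-o(1)}$ time.
   Context: All-Nodes Shortest Cycles (ANSC): for every vertex $v$ compute $SC(v)$, the length of a shortest (simple) cycle through $v$; approximation ratio $\alpha$ means estimates $\hat c_v$ with $SC(v)\le\hat c_v\le\alpha SC(v)$ for all $v$. All-Edges Sparse Triangle problem: given an undirected graph with $m$ edges, output for each edge whether it lies in a triangle. All-Edges Sparse Triangle Hypothesis: there is no $O(m^{4/3-\varepsilon})$-time algorithm for this problem, for any constant $\varepsilon>0$. *)

(* Defs.v *)
(* MathComp and MathComp-Analysis. *)
From mathcomp Require Import all_boot all_order all_algebra.
From mathcomp Require Import all_classical all_reals all_analysis.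

Set Implicit Arguments.
Unset Strict Implicit.
Unset Printing Implicit Defensive.

Import Order.TTheory GRing.Theory Num.Theory.
Import numFieldNormedType.Exports.

Local Open Scope classical_set_scope.
Local Open Scope nat_scope.

(* Word RAM: a register file and a random-access memory, both indexed by nat,
   whose cells hold words of O(log s) bits on inputs of s words. *)

Inductive binop :=
  OpAdd | OpSub | OpMul | OpDiv | OpMod |
  OpAnd | OpOr | OpXor | OpShl | OpShr | OpLt.

Definition eval_binop (o : binop) (a b : nat) : nat :=
  match o with
  | OpAdd => a + b
  | OpSub => a - b
  | OpMul => a * b
  | OpDiv => a %/ b
  | OpMod => a %% b
  | OpAnd => Nat.land a b
  | OpOr  => Nat.lor a b
  | OpXor => Nat.lxor a b
  | OpShl => a * 2 ^ b
  | OpShr => a %/ 2 ^ b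
  | OpLt  => a < b
  end.

Inductive instr :=
  | Const of nat & nat                (* reg d := k *)
  | Op of binop & nat & nat & nat     (* reg d := reg a `o` reg b *)
  | Read of nat & nat                 (* reg d := memory (reg a) *)
  | Write of nat & nat                (* memory (reg a) := reg b *)
  | Jump of nat                       (* goto l *)
  | Jz of nat & nat                   (* if reg a = 0 then goto l *)
  | Flip of nat                       (* reg d := next random bit *)
  | Halt.

Definition program := seq instr.

Record config := Config {
  pc : nat;
  regs : nat -> nat;
  memory : nat -> nat;
  coins : seq bool
}.

(* Leaving the program text is the same as reaching Halt. *)
Definition fetch (p : program) (s : config) : instr := nth Halt p (pc s).

Definition halted (p : program) (s : config) : bool :=
  if fetch p s is Halt then true else false.

Definition set_reg (W d v : nat) (s : config) : option config :=
  if v < W then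
    Some (Config (pc s).+1 [eta regs s with d |-> v] (memory s) (coins s))
  else None.

(* One unit-cost step on words in [0, W).  The result None is a crash: a value
   that does not fit in a word, or a coin request on an exhausted tape.
   Modular arithmetic is not built in; programs can compute it with OpMod. *)
Definition step (W : nat) (p : program) (s : config) : option config :=
  match fetch p s with
  | Const d k => set_reg W d k s
  | Op o d a b => set_reg W d (eval_binop o (regs s a) (regs s b)) s
  | Read d a => set_reg W d (memory s (regs s a)) s
  | Write a b =>
      Some (Config (pc s).+1 (regs s)
                   [eta memory s with regs s a |-> regs s b] (coins s))
  | Jump l => Some (Config l (regs s) (memory s) (coins s))
  | Jz a l =>
      Some (Config (if regs s a == 0 then l else (pc s).+1)
                   (regs s) (memory s) (coins s))
  | Flip d =>
      if coins s is b :: r then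
        set_reg W d b (Config (pc s) (regs s) (memory s) r)
      else None
  | Halt => Some s
  end.

Definition init (input : seq nat) (tape : seq bool) : config :=
  Config 0 (fun=> 0) (nth 0 input) tape.

Definition run (W : nat) (p : program) (t : nat) (s : config) : option config :=
  iter t (obind (step W p)) (Some s).

(* Words of c * log2 (s + 2) bits, s being the length of the input. *)
Definition word_bound (c : nat) (input : seq nat) : nat := (size input + 2) ^ c.

(* [correct x M]: the memory contents M is an acceptable output on x.
   [param x] is the parameter in which running times are measured. *)
Record problem := Problem {
  instance : Type;
  param : instance -> nat;
  encode : instance -> seq nat;
  correct : instance -> (nat -> nat) -> Prop
}.

Definition succeeds (P : problem) (p : program) (c t : nat) (x : instance P)
    (tape : seq bool) : Prop :=
  exists s : config,
    [/\ run (word_bound c (encode x)) p t (init (encode x) tape) = Some s,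
        halted p s & correct x (memory s)].

Inductive mode := Deterministic | Randomized.

(* [P] has an algorithm of worst-case running time at most [t].  A single
   program and a single word-length constant serve all instances.  Randomized
   algorithms are Monte Carlo with error probability at most 1/3, over tapes of
   some length L of independent fair coins. *)
Definition solvable_in (k : mode) (P : problem) (t : nat -> nat) : Prop :=
  exists (p : program) (c : nat), forall x : instance P,
    match k with
    | Deterministic => succeeds p c (t (param x)) x [::]
    | Randomized => exists L : nat,
        2 * 2 ^ L <=
        3 * #|[pred w : L.-tuple bool | `[< succeeds p c (t (param x)) x w >]]|
    end.

(* t = O(m^a) *)
Definition time_O (R : realType) (t : nat -> nat) (a : R) : Prop :=
  (fun m : nat => ((t m)%:R)%R : R^o) =O_\oo
  (fun m : nat => ((m%:R : R) `^ a)%R : R^o).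

(* "[P] requires m^(a - o(1)) time": for no constant eps > 0 is there an
   O(m^(a - eps))-time algorithm, m being the parameter of the instance. *)
Definition requires_time (R : realType) (k : mode) (P : problem) (a : R) : Prop :=
  forall (eps : R) (t : nat -> nat),
    (0 < eps)%R -> solvable_in k P t -> ~ time_O t (a - eps)%R.

Definition adj_of (n m : nat) (es : m.-tuple ('I_n * 'I_n)) : rel 'I_n :=
  fun u v => ((u, v) \in es) || ((v, u) \in es).

(* A simple undirected graph, listing each edge once, in one orientation (this
   excludes loops, which are their own reversal).  Isolated vertices are
   excluded, so that nverts <= 2 * nedges and the number of edges measures the
   size of the graph. *)
Record graph := Graph {
  nverts : nat;
  nedges : nat;
  edges : nedges.-tuple ('I_nverts * 'I_nverts);
  edges_uniq : uniq edges;
  edges_oriented : forall e, e \in edges -> (e.2, e.1) \notin edges;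
  no_isolated : forall u, exists v, adj_of edges u v
}.

Definition adj (G : graph) : rel 'I_(nverts G) := adj_of (edges G).

Definition encode_graph (G : graph) : seq nat :=
  [:: nverts G, nedges G &
      flatten [seq [:: val e.1; val e.2] | e <- edges G]].

Definition in_triangle (G : graph) (e : 'I_(nverts G) * 'I_(nverts G)) : bool :=
  [exists w, adj e.1 w && adj e.2 w].

Definition AE_Sparse_Triangle : problem := {|
  instance := graph;
  param := nedges;
  encode := encode_graph;
  correct := fun G M =>
    forall i : 'I_(nedges G), M i = in_triangle (tnth (edges G) i)
|}.

Definition simple_cycle_through (G : graph) (v : 'I_(nverts G))
    (c : seq 'I_(nverts G)) : Prop :=
  [/\ ucycle (@adj G) c, 2 < size c & v \in c].

(* SC(v), which is +oo when v lies on no cycle. *)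
Definition SC (R : realType) (G : graph) (v : 'I_(nverts G)) : \bar R :=
  ereal_inf [set ((size c)%:R)%R%:E | c in simple_cycle_through v].

(* Estimates are output as words, with 0 standing for +oo.  Integrality is no
   restriction: SC(v) is an integer or +oo, so estimates may be rounded down. *)
Definition estimate (R : realType) (w : nat) : \bar R :=
  if w == 0 then +oo%E else (w%:R)%R%:E.

Definition approx_ANSC (R : realType) (alpha : R) : problem := {|
  instance := graph;
  param := nedges;
  encode := encode_graph;
  correct := fun G M => forall v : 'I_(nverts G),
    (SC R v <= estimate R (M v) <= alpha%:E * SC R v)%E
|}.

Definition AE_Sparse_Triangle_Hypothesis (R : realType) (k : mode) : Prop :=
  ~ exists (eps : R) (t : nat -> nat),
      [/\ (0 < eps)%R, solvable_in k AE_Sparse_Triangle t &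
          time_O t (4 / 3 - eps)%R].

(* Main.v *)
(* Given G with edges e_0, ..., e_(m-1), let H be the bipartite graph with
   vertices mid i (i < m), ver v and cop v (v a vertex of G), in which mid i is
   joined to both ends of e_i (e_i is subdivided), and cop w to ver v whenever
   w and v are adjacent in G.  A 4-cycle through mid i must be mid i, ver u,
   cop w, ver v with e_i = {u, v} and w a common neighbour of u and v, so SC(mid i)
   is 4 if e_i lies in a triangle and at least 6 otherwise; an approximation
   ratio below 3/2 tells these cases apart.  H has 4m edges and is written in
   O(m) time, so an ANSC algorithm becomes a triangle algorithm with the same
   exponent (capped below at 1, which is less than 4/3). *)

Require Import Defs.
From mathcomp Require Import all_boot all_order all_algebra.
From mathcomp Require Import all_classical all_reals all_analysis.
From mathcomp Require Import zify lra.

Import Order.TTheory GRing.Theory Num.Theory.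

(** * Executions within a step budget *)

(** Budgets are upper bounds because the exact step count depends on the simulated run. Nothing is
    lost: [Halt] fixes the state, so a budget ending in a halted state becomes an exact run
    length. *)
Definition reaches (W : nat) (P : program) (t : nat) (s s' : config) : Prop :=
  exists2 t', t' <= t & run W P t' s = Some s'.

Lemma run_add W P t1 t2 s s1 :
  run W P t1 s = Some s1 -> run W P (t1 + t2) s = run W P t2 s1.
Proof. by rewrite /run addnC iterD => ->. Qed.

Lemma run_step W P t s :
  run W P t.+1 s = if step W P s is Some s1 then run W P t s1 else None.
Proof.
rewrite /run iterSr /=; case: (step W P s) => //=.
by elim: t => //= t ->.
Qed.

Lemma reaches_refl W P t s : reaches W P t s s.
Proof. by exists 0. Qed.

Lemma reaches_trans W P t1 t2 s1 s2 s3 :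
  reaches W P t1 s1 s2 -> reaches W P t2 s2 s3 -> reaches W P (t1 + t2) s1 s3.
Proof.
move=> [a a1 r1] [b b2 r2]; exists (a + b); first exact: leq_add.
by rewrite (run_add _ _ _ _ _ _ r1).
Qed.

Lemma reaches_step W P t s s1 s2 :
  step W P s = Some s1 -> reaches W P t s1 s2 -> reaches W P t.+1 s s2.
Proof.
by move=> st [a at1 r]; exists a.+1; rewrite ?ltnS // run_step st.
Qed.

Lemma reaches_le W P t t' s s' :
  t <= t' -> reaches W P t s s' -> reaches W P t' s s'.
Proof. by move=> tt' [a at1 r]; exists a => //; apply: leq_trans tt'. Qed.

Lemma run_halted W P t s : halted P s -> run W P t s = Some s.
Proof.
move=> hs; have st : step W P s = Some s.
  by move: hs; rewrite /halted /step; case: (fetch P s).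
by elim: t => // t IH; rewrite run_step st.
Qed.

Lemma reaches_halted W P t s s' :
  reaches W P t s s' -> halted P s' -> run W P t s = Some s'.
Proof.
move=> [a at1 r] hs; rewrite -(subnKC at1) (run_add _ _ _ _ _ _ r).
exact: run_halted.
Qed.

(** * The wrapper program and its simulation of the given one *)

(* The code at 0-41 rewrites the encoding of G into that of the gadget in place,
   from the last edge to the first so that no unread edge is overwritten, and
   jumps to the given program, which is relocated to 53.  The code at 42-52
   replaces the first m output words w by the truth value of 0 < w < 6 (the word
   0 stands for +oo).  It relies on registers 0-2 holding 0, 1 and m, which the
   relocated program preserves, as it only uses registers from 20 on. *)
Definition main : program := [::
  (*  0 *) Const 1 1; Read 2 1; Read 3 0; Op OpAdd 4 2 3;
  (*  4 *) Const 5 2; Const 6 8; Const 7 4; Op OpAdd 8 4 3;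
  (*  8 *) Write 0 8; Op OpMul 8 7 2; Write 1 8; Op OpAdd 9 2 0;
  (* 12 *) Jz 9 41; Op OpSub 9 9 1; Op OpMul 10 9 5; Op OpAdd 10 10 5;
  (* 16 *) Read 11 10; Op OpAdd 10 10 1; Read 12 10;
  (* 19 *) Op OpMul 10 9 6; Op OpAdd 10 10 5;
  (* 21 *) Op OpAdd 13 2 11; Op OpAdd 14 2 12; Op OpAdd 15 4 11; Op OpAdd 16 4 12;
  (* 25 *) Write 10 9; Op OpAdd 10 10 1; Write 10 13; Op OpAdd 10 10 1;
  (* 29 *) Write 10 9; Op OpAdd 10 10 1; Write 10 14; Op OpAdd 10 10 1;
  (* 33 *) Write 10 16; Op OpAdd 10 10 1; Write 10 13; Op OpAdd 10 10 1;
  (* 37 *) Write 10 15; Op OpAdd 10 10 1; Write 10 14; Jump 12;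
  (* 41 *) Jump 53;
  (* 42 *) Const 3 6; Op OpAdd 9 2 0;
  (* 44 *) Jz 9 52; Op OpSub 9 9 1; Read 10 9; Op OpLt 11 0 10;
  (* 48 *) Op OpLt 12 10 3; Op OpMul 11 11 12; Write 9 11; Jump 44;
  (* 52 *) Halt].

Definition relocate (n : nat) (i : instr) : instr :=
  match i with
  | Const d k => Const (20 + d) k
  | Op o d a b => Op o (20 + d) (20 + a) (20 + b)
  | Read d a => Read (20 + d) (20 + a)
  | Write a b => Write (20 + a) (20 + b)
  | Jump l => Jump (53 + minn l n)
  | Jz a l => Jz (20 + a) (53 + minn l n)
  | Flip d => Flip (20 + d)
  | Halt => Jump 42
  end.

Definition wrap (p : program) : program :=
  main ++ map (relocate (size p)) p ++ [:: Jump 42].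

(* The minimum sends every program counter outside p to the final jump of
   wrap p. *)
Definition sim (p : program) (s s' : config) : Prop :=
  [/\ pc s' = 53 + minn (pc s) (size p),
      forall r, regs s' (20 + r) = regs s r,
      memory s' = memory s & coins s' = coins s].

Definition low_eq (s s' : config) : Prop :=
  forall r, r < 20 -> regs s' r = regs s r.

(** No range condition is needed: outside [p] the fetched instruction is the default [Halt], and its
    relocation is the trailing [Jump 42]. *)
Lemma fetch_sim p s s' :
  sim p s s' -> fetch (wrap p) s' = relocate (size p) (fetch p s).
Proof.
move=> [pcE _ _ _]; rewrite /fetch pcE /wrap nth_cat.
rewrite (_ : size main = 53) // ltnNge leq_addr [~~ true]/= addKn nth_cat size_map.
case: (ltnP (pc s) (size p)) => h; first by rewrite h (nth_map Halt).
by rewrite ltnn subnn (nth_default _ h).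
Qed.

Lemma sim_step W W' p s s1 s' :
  W <= W' -> sim p s s' -> ~~ halted p s -> step W p s = Some s1 ->
  exists2 s1', step W' (wrap p) s' = Some s1' & sim p s1 s1' /\ low_eq s' s1'.
Proof.
move=> WW' ss' nh.
(* A state that has not halted has its counter inside [p], so the minimum is still inactive
   there. *)
have pcS : minn (pc s).+1 (size p) = (minn (pc s) (size p)).+1.
  have : pc s < size p.
    rewrite ltnNge; apply: contra nh => h.
    by rewrite /halted /fetch nth_default.
  lia.
(* [c] and [c'] may differ from [s] and [s'] in their coins, because [Flip] removes a coin before it
   assigns. *)
have key d v (c c' : config) : pc c' = 53 + minn (pc c) (size p) -> 
    pc c = pc s -> memory c' = memory c -> coins c' = coins c ->
    regs c' = regs s' -> regs c = regs s ->
    set_reg W d v c = Some s1 ->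
    exists2 s1', set_reg W' (20 + d) v c' = Some s1' &
      sim p s1 s1' /\ low_eq s' s1'.
  move=> pcE pcs mE cE rE' rE; rewrite /set_reg; case: ifP => // vW [<-].
  rewrite (leq_trans vW WW'); eexists; first by [].
  split; first split => //=.
  - by rewrite pcE pcs pcS addnS.
  - move=> r; rewrite rE rE' eqn_add2l; case: eqP => // _.
    by case: ss' => _ ->.
  - move=> r r20 /=; case: eqP => [rE2|_]; last by rewrite rE'.
    by move: r20; rewrite rE2 ltnNge leq_addr.
have := fetch_sim _ _ _ ss'.
case: (ss') => pcE rE mE cE fE.
move: nh; rewrite /halted /step fE; case: (fetch p s) => //=.
- by move=> d v _; apply: key.
- by move=> o d a b _; rewrite !rE; apply: key.
- by move=> d a _; rewrite !rE mE; apply: key.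
- move=> a b _ [<-]; eexists; first by [].
  by split => //; split => //=; rewrite ?pcE ?pcS ?addnS // !rE mE.
- move=> l _ [<-]; eexists; first by [].
  by split => //; split => //=; rewrite minnAC minnn.
- move=> a l _ [<-]; eexists; first by [].
  split => //; split => //=; rewrite rE; case: ifP => //.
  by rewrite pcE pcS addnS.
- move=> d _; rewrite cE; case: (coins s) => // b r.
  exact: key.
Qed.

(** Steps correspond one to one until [p] halts; the extra step is the jump to 42 that replaces
    [Halt]. *)
Lemma sim_run W W' p t s sf s' :
  W <= W' -> sim p s s' -> run W p t s = Some sf -> halted p sf ->
  exists s1, [/\ reaches W' (wrap p) t.+1 s' s1, pc s1 = 42,
                 memory s1 = memory sf & low_eq s' s1].
Proof.
move=> WW'; elim: t s s' => [|t IH] s s' ss'.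
  case=> <- hs; exists (Config 42 (regs s') (memory s') (coins s')); split => //.
    apply: reaches_step (reaches_refl _ _ _ _).
    rewrite /step (fetch_sim _ _ _ ss'); move: hs.
    by rewrite /halted; case: (fetch p s).
  by case: ss'.
case: (boolP (halted p s)) => hs.
  rewrite (run_halted _ _ _ _ hs) => -[sE] hsf.
  have [||s1 [h1 h2 h3 h4]] := IH s s' ss' => //.
    by rewrite run_halted // sE.
  by exists s1; split => //; apply: reaches_le h1.
rewrite run_step; case E: (step W p s) => [s1|//] r hsf.
have [s1' st [ss1 lo1]] := sim_step _ _ _ _ _ _ WW' ss' hs E.
have [s2 [h1 h2 h3 h4]] := IH s1 s1' ss1 r hsf.
exists s2; split => //; first exact: reaches_step st h1.
by move=> i i20; rewrite h4 // lo1.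
Qed.

(** * Symbolic execution of the fixed code *)

Lemma fetch_main p i R M C :
  i < 53 -> fetch (wrap p) (Config i R M C) = nth Halt main i.
Proof. by move=> i53; rewrite /fetch /wrap nth_cat /= i53. Qed.

Definition assigned (i : instr) (R M : nat -> nat) : option (nat * nat) :=
  match i with
  | Const d k => Some (d, k)
  | Op o d a b => Some (d, eval_binop o (R a) (R b))
  | Read d a => Some (d, M (R a))
  | _ => None
  end.

(** The value [v] is a separate parameter so that each use can name it in simplified form, which
    keeps the register file readable over long stretches of code. *)
Lemma reaches_set d v W p t i R M C s :
  i < 53 -> assigned (nth Halt main i) R M = Some (d, v) -> v < W ->
  reaches W (wrap p) t (Config i.+1 [eta R with d |-> v] M C) s ->
  reaches W (wrap p) t.+1 (Config i R M C) s.
Proof.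
move=> i53 av vW; apply: reaches_step; rewrite /step fetch_main //.
by case: (nth Halt main i) av => //= [d' k|o d' a b|d' a] [-> ->]; rewrite /set_reg vW.
Qed.

Lemma reaches_write a v W p t i R M C s :
  i < 53 -> (if nth Halt main i is Write a' b' then Some (R a', R b') else None) =
            Some (a, v) ->
  reaches W (wrap p) t (Config i.+1 R [eta M with a |-> v] C) s ->
  reaches W (wrap p) t.+1 (Config i R M C) s.
Proof.
move=> i53 av; apply: reaches_step; rewrite /step fetch_main //.
by case: (nth Halt main i) av => //= a' b' [-> ->].
Qed.

Lemma reaches_jump l W p t i R M C s :
  i < 53 ->
  match nth Halt main i with
  | Jump l' => Some l'
  | Jz a l' => Some (if R a == 0 then l' else i.+1)
  | _ => None
  end = Some l ->
  reaches W (wrap p) t (Config l R M C) s ->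
  reaches W (wrap p) t.+1 (Config i R M C) s.
Proof.
move=> i53 av; apply: reaches_step; rewrite /step fetch_main //.
by case: (nth Halt main i) av => //= [l'|a l'] [->].
Qed.


(** * Preprocessing: expanding the edge list in place *)

(* U and V list the ends of the edges. *)
Record bounds (W n m : nat) (U V : nat -> nat) : Prop := Bounds {
  bound_const : 16 <= W;
  bound_addr : 8 * m + 10 <= W;
  bound_verts : n <= 2 * m;
  bound_U : forall i, i < m -> U i < n;
  bound_V : forall i, i < m -> V i < n }.

(* The eight words that encode the four gadget edges arising from edge i. *)
Definition block (n m : nat) (U V : nat -> nat) (i k : nat) : nat :=
  nth 0 [:: i; m + U i; i; m + V i;
            m + n + V i; m + U i; m + n + U i; m + V i] k.

(* E is the memory to be produced; edges i, ..., m - 1 have been expanded. *)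
Record pre_inv (n m : nat) (U V E : nat -> nat) (i : nat) (R M : nat -> nat) :
    Prop := PreInv {
  pre_r0 : R 0 = 0;
  pre_r1 : R 1 = 1;
  pre_r2 : R 2 = m;
  pre_r4 : R 4 = m + n;
  pre_r5 : R 5 = 2;
  pre_r6 : R 6 = 8;
  pre_r9 : R 9 = i;
  pre_high : forall r, R (20 + r) = 0;
  pre_U : forall j, j < i -> M (2 * j + 2) = U j;
  pre_V : forall j, j < i -> M (2 * j + 2 + 1) = V j;
  pre_header : forall a, a < 2 -> M a = E a;
  pre_done : forall a, 8 * i + 2 <= a -> M a = E a }.

(** The ends of edge [i] are read before addresses [8 * i + 2] to [8 * i + 9] are written, and the
    unread edges lie below [2 * i + 2], so they survive. The budget 29 counts instructions 12 to
    40. *)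
Lemma pre_iter W n m U V p E i R M C :
  bounds W n m U V ->
  (forall j k, j < m -> k < 8 -> E (8 * j + 2 + k) = block n m U V j k) ->
  i < m -> pre_inv n m U V E i.+1 R M ->
  exists R' M', pre_inv n m U V E i R' M' /\
    reaches W (wrap p) 29 (Config 12 R M C) (Config 12 R' M' C).
Proof.
move=> [W16 mW nm Un Vn] EE im [r0 r1 r2 r4 r5 r6 r9 rh mU mV m2 md].
have Ui := Un i im; have Vi := Vn i im.
have MU := mU i (leqnn _); have MV := mV i (leqnn _).
(* The execution goal comes first: running the code instantiates the final registers and memory. *)
do 2 eexists; split; last first.
  apply: (reaches_jump 13) => //=; first by rewrite r9.
  apply: (reaches_set 9 i) => //=; [by rewrite r9 r1 subn1|lia|].
  apply: (reaches_set 10 (2 * i)) => //=; [by rewrite r5 mulnC|lia|].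
  apply: (reaches_set 10 (2 * i + 2)) => //=; [by rewrite r5|lia|].
  apply: (reaches_set 11 (U i)) => //=; [by rewrite MU|lia|].
  apply: (reaches_set 10 (2 * i + 2 + 1)) => //=; [by rewrite r1|lia|].
  apply: (reaches_set 12 (V i)) => //=; [by rewrite MV|lia|].
  apply: (reaches_set 10 (8 * i)) => //=; [by rewrite r6 mulnC|lia|].
  apply: (reaches_set 10 (8 * i + 2)) => //=; [by rewrite r5|lia|].
  apply: (reaches_set 13 (m + U i)) => //=; [by rewrite r2|lia|].
  apply: (reaches_set 14 (m + V i)) => //=; [by rewrite r2|lia|].
  apply: (reaches_set 15 (m + n + U i)) => //=; [by rewrite r4|lia|].
  apply: (reaches_set 16 (m + n + V i)) => //=; [by rewrite r4|lia|].
  apply: (reaches_write (8 * i + 2) i) => //=.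
  apply: (reaches_set 10 (8 * i + 2 + 1)) => //=; [by rewrite r1|lia|].
  apply: (reaches_write (8 * i + 2 + 1) (m + U i)) => //=.
  apply: (reaches_set 10 (8 * i + 2 + 2)) => //=; [by rewrite r1 -addnA|lia|].
  apply: (reaches_write (8 * i + 2 + 2) i) => //=.
  apply: (reaches_set 10 (8 * i + 2 + 3)) => //=; [by rewrite r1 -addnA|lia|].
  apply: (reaches_write (8 * i + 2 + 3) (m + V i)) => //=.
  apply: (reaches_set 10 (8 * i + 2 + 4)) => //=; [by rewrite r1 -addnA|lia|].
  apply: (reaches_write (8 * i + 2 + 4) (m + n + V i)) => //=.
  apply: (reaches_set 10 (8 * i + 2 + 5)) => //=; [by rewrite r1 -addnA|lia|].
  apply: (reaches_write (8 * i + 2 + 5) (m + U i)) => //=.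
  apply: (reaches_set 10 (8 * i + 2 + 6)) => //=; [by rewrite r1 -addnA|lia|].
  apply: (reaches_write (8 * i + 2 + 6) (m + n + U i)) => //=.
  apply: (reaches_set 10 (8 * i + 2 + 7)) => //=; [by rewrite r1 -addnA|lia|].
  apply: (reaches_write (8 * i + 2 + 7) (m + V i)) => //=.
  apply: (reaches_jump 12) => //=.
  exact: reaches_refl.
have old a : a < 8 * i + 2 ->
    [eta [eta [eta [eta [eta [eta [eta [eta M
      with 8 * i + 2 |-> i] with 8 * i + 2 + 1 |-> m + U i]
      with 8 * i + 2 + 2 |-> i] with 8 * i + 2 + 3 |-> m + V i]
      with 8 * i + 2 + 4 |-> m + n + V i] with 8 * i + 2 + 5 |-> m + U i]
      with 8 * i + 2 + 6 |-> m + n + U i] with 8 * i + 2 + 7 |-> m + V i] a = M a.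
  by move=> ai /=; do !(rewrite ifF; last by apply/eqP; lia).
split => //.
- by move=> j ji; rewrite old ?mU; lia.
- by move=> j ji; rewrite old ?mV; lia.
- by move=> a a2; rewrite old ?m2; lia.
- move=> a ai /=; do 7![case: eqP => [->|?]; first by rewrite EE].
  case: eqP => [->|a0]; first by rewrite -[8 * i + 2]addn0 EE.
  by apply: md; lia.
Qed.

Lemma pre_loop W n m U V p E i R M C :
  bounds W n m U V ->
  (forall j k, j < m -> k < 8 -> E (8 * j + 2 + k) = block n m U V j k) ->
  i <= m -> pre_inv n m U V E i R M ->
  exists R' M', pre_inv n m U V E 0 R' M' /\
    reaches W (wrap p) (29 * i + 2) (Config 12 R M C) (Config 53 R' M' C).
Proof.
move=> bW EE; elim: i R M => [|i IH] R M im inv.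
  exists R, M; split=> //.
  apply: (reaches_jump 41) => //=; first by case: inv => _ _ _ _ _ _ ->.
  by apply: (reaches_jump 53) => //=; apply: reaches_refl.
have [R1 [M1 [inv1 r1]]] := pre_iter _ _ _ _ _ p _ _ _ _ C bW EE im inv.
have [R2 [M2 [inv2 r2]]] := IH _ _ (ltnW im) inv1.
exists R2, M2; split=> //; rewrite mulnS -addnA.
exact: reaches_trans r1 r2.
Qed.

Lemma pre_correct W n m U V p E M C :
  bounds W n m U V ->
  M 0 = n -> M 1 = m ->
  (forall j, j < m -> M (2 * j + 2) = U j) ->
  (forall j, j < m -> M (2 * j + 2 + 1) = V j) ->
  (forall a, 8 * m + 2 <= a -> M a = 0) ->
  E 0 = m + n + n -> E 1 = 4 * m ->
  (forall j k, j < m -> k < 8 -> E (8 * j + 2 + k) = block n m U V j k) ->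
  (forall a, 8 * m + 2 <= a -> E a = 0) ->
  exists R, [/\ R 0 = 0, R 1 = 1, R 2 = m, forall r, R (20 + r) = 0 &
    reaches W (wrap p) (29 * m + 14) (Config 0 (fun=> 0) M C) (Config 53 R E C)].
Proof.
move=> bW M0 M1 MU MV Mz E0 E1 EE Ez; have [W16 mW nm _ _] := bW.
(* The displayed updates are the state left by the twelve instructions before the loop. *)
have [||R [M' [inv r]]] := pre_loop W n m U V p E m
  [eta [eta [eta [eta [eta [eta [eta [eta [eta [eta (fun=> 0)
    with 1 |-> 1] with 2 |-> m] with 3 |-> n] with 4 |-> m + n] with 5 |-> 2]
    with 6 |-> 8] with 7 |-> 4] with 8 |-> m + n + n] with 8 |-> 4 * m]
    with 9 |-> m]
  [eta [eta M with 0 |-> m + n + n] with 1 |-> 4 * m] C bW EE => //.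
  split => //=.
  - by move=> j jm; rewrite !ifF ?MU //; apply/eqP; lia.
  - by move=> j jm; rewrite !ifF ?MV //; apply/eqP; lia.
  - by case=> [|[|]].
  - by move=> a ma; rewrite !ifF ?Mz ?Ez //; apply/eqP; lia.
have {}r : reaches W (wrap p) (29 * m + 14) (Config 0 (fun=> 0) M C)
                   (Config 53 R M' C).
  rewrite (_ : 29 * m + 14 = (29 * m + 2) + 12); last by lia.
  rewrite addnC; do 12![rewrite addSn]; rewrite add0n.
  apply: (reaches_set 1 1) => [//|//||]; first by rewrite /=; lia.
  apply: (reaches_set 2 m) => [//|||]; [by rewrite /= M1|lia|].
  apply: (reaches_set 3 n) => [//|||]; [by rewrite /= M0|lia|].
  apply: (reaches_set 4 (m + n)) => [//|//||]; first by rewrite /=; lia.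
  apply: (reaches_set 5 2) => [//|//||]; first by rewrite /=; lia.
  apply: (reaches_set 6 8) => [//|//||]; first by rewrite /=; lia.
  apply: (reaches_set 7 4) => [//|//||]; first by rewrite /=; lia.
  apply: (reaches_set 8 (m + n + n)) => [//|//||]; first by rewrite /=; lia.
  apply: (reaches_write 0 (m + n + n)) => [//|//|].
  apply: (reaches_set 8 (4 * m)) => [//|//||]; first by rewrite /=; lia.
  apply: (reaches_write 1 (4 * m)) => [//|//|].
  apply: (reaches_set 9 m) => [//|||]; [by rewrite /= addn0|lia|].
  exact: r.
(* On exit the header and the finished blocks cover every address, so the memories agree as
   functions and the relocated program sees exactly the gadget's encoding. *)
have ME : M' = E.
  apply/funext => a; case: (ltnP a 2) => a2; first exact: (pre_header _ _ _ _ _ _ _ _ inv).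
  by apply: (pre_done _ _ _ _ _ _ _ _ inv); rewrite muln0.
exists R; rewrite -ME; case: inv => ? ? ? *; split => //.
Qed.

(** * Postprocessing: thresholding the estimates *)

(* F is the memory left by the relocated program. *)
Record post_inv (m : nat) (F : nat -> nat) (i : nat) (R M : nat -> nat) :
    Prop := PostInv {
  post_r0 : R 0 = 0;
  post_r1 : R 1 = 1;
  post_r3 : R 3 = 6;
  post_r9 : R 9 = i;
  post_todo : forall j, j < i -> M j = F j;
  post_done : forall j, i <= j < m -> M j = (0 < F j < 6) }.

(** The bound on [F] keeps the machine from crashing when an output word is read into a register.
    The conjunction is computed as a product of two truth values. *)
Lemma post_loop W p m F i R M C :
  16 <= W -> i <= m -> m <= W -> (forall j, F j < W) -> post_inv m F i R M ->
  exists R' (M' : nat -> nat), (forall j, j < m -> M' j = (0 < F j < 6)) /\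
    reaches W (wrap p) (8 * i + 1) (Config 44 R M C) (Config 52 R' M' C).
Proof.
move=> W16 im mW FW; elim: i im R M => [|i IH] im R M [r0 r1 r3 r9 todo dn].
  exists R, M; split=> //.
  by apply: (reaches_jump 52) => //=; [rewrite r9|apply: reaches_refl].
have Fi := todo i (leqnn _).
set b1 : nat := 0 < F i; set b2 : nat := F i < 6.
have b1W : b1 < W by apply: leq_ltn_trans (leq_b1 _) _; lia.
have b2W : b2 < W by apply: leq_ltn_trans (leq_b1 _) _; lia.
have bE : b1 * b2 = (0 < F i < 6) by rewrite mulnb.
have [|R' [M' [M'E r]]] := IH (ltnW im)
  [eta [eta [eta [eta [eta R with 9 |-> i] with 10 |-> F i] with 11 |-> b1]
    with 12 |-> b2] with 11 |-> b1 * b2]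
  [eta M with i |-> b1 * b2].
  split => //=.
  - by move=> j ji; rewrite ifF ?todo; [|lia|apply/eqP; lia].
  - move=> j ijm; case: eqP => [->|ji]; first exact: bE.
    by apply: dn; lia.
exists R', M'; split=> //; rewrite mulnS -addnA; do 8![rewrite addSn]; rewrite add0n.
apply: (reaches_jump 45) => //=; first by rewrite r9.
apply: (reaches_set 9 i) => //=; [by rewrite r9 r1 subn1|lia|].
apply: (reaches_set 10 (F i)) => //=; first by rewrite Fi.
apply: (reaches_set 11 b1) => //=; first by rewrite r0.
apply: (reaches_set 12 b2) => //=; first by rewrite r3.
apply: (reaches_set 11 (b1 * b2)) => //=.
  by rewrite bE; apply: leq_ltn_trans (leq_b1 _) _; lia.
apply: (reaches_write i (b1 * b2)) => //=.
apply: (reaches_jump 44) => //=.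
Qed.

Lemma post_correct W p m R M C :
  16 <= W -> m < W -> (forall j, M j < W) ->
  R 0 = 0 -> R 1 = 1 -> R 2 = m ->
  exists R' (M' : nat -> nat), (forall j, j < m -> M' j = (0 < M j < 6)) /\
    reaches W (wrap p) (8 * m + 3) (Config 42 R M C) (Config 52 R' M' C).
Proof.
move=> W16 mW MW R0 R1 R2.
have [|R' [M' [M'E r]]] := post_loop W p m M m
  [eta [eta R with 3 |-> 6] with 9 |-> m] M C W16 (leqnn m) (ltnW mW) MW.
  by split => //= j; lia.
exists R', M'; split => //; rewrite (_ : 8 * m + 3 = (8 * m + 1).+2); last lia.
apply: (reaches_set 3 6) => //=; first by lia.
apply: (reaches_set 9 m) => //=; first by rewrite R0 R2 addn0.
Qed.

(** * Word sizes and correctness of the whole program *)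

Definition bounded (W : nat) (s : config) : Prop :=
  (forall r, regs s r < W) /\ (forall a, memory s a < W).

Lemma step_bounded W W' p s s1 :
  W <= W' -> bounded W' s -> step W p s = Some s1 -> bounded W' s1.
Proof.
move=> WW' [rW mW]; have key d v c :
    regs c = regs s -> memory c = memory s -> set_reg W d v c = Some s1 ->
    bounded W' s1.
  move=> rE mE; rewrite /set_reg; case: ifP => // vW [<-].
  split=> a /=; last by rewrite mE.
  by case: eqP => _; [apply: leq_trans WW'|rewrite rE].
rewrite /step; case: (fetch p s) => [d k|o d a b|d a|a b|l|a l|d|];
  try exact: key; try by case=> <-.
- by case=> <-; split=> //= i; case: eqP.
- by case: (coins s) => // b c; apply: key.
Qed.

(** This supplies the bound that postprocessing needs on the output of [p]: new values enter only
    through [set_reg], which checks them, and memory receives only copies of registers. *)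
Lemma run_bounded W W' p t s s1 :
  W <= W' -> bounded W' s -> run W p t s = Some s1 -> bounded W' s1.
Proof.
move=> WW'; elim: t s => [|t IH] s bs; first by case=> <-.
rewrite run_step; case E: (step W p s) => [s2|//].
by apply: IH; apply: step_bounded E.
Qed.

Lemma wrap_correct W W' n m U V p E M C t s :
  bounds W' n m U V ->
  M 0 = n -> M 1 = m ->
  (forall j, j < m -> M (2 * j + 2) = U j) ->
  (forall j, j < m -> M (2 * j + 2 + 1) = V j) ->
  (forall a, 8 * m + 2 <= a -> M a = 0) ->
  E 0 = m + n + n -> E 1 = 4 * m ->
  (forall j k, j < m -> k < 8 -> E (8 * j + 2 + k) = block n m U V j k) ->
  (forall a, 8 * m + 2 <= a -> E a = 0) ->
  W <= W' -> run W p t (Config 0 (fun=> 0) E C) = Some s -> halted p s ->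
  exists s', [/\ run W' (wrap p) (t + 37 * m + 18) (Config 0 (fun=> 0) M C) = Some s',
                 halted (wrap p) s' &
                 forall j, j < m -> memory s' j = (0 < memory s j < 6)].
Proof.
move=> bW M0 M1 MU MV Mz E0 E1 EE Ez WW' rs hs.
have [W16 mW nm Um Vm] := bW.
(* The simulated run must start from words that fit. Past the header, an address splits into a block
   number and an offset modulo 8. *)
have EW a : E a < W'.
  case: (ltnP a (8 * m + 2)) => [am|?]; last by rewrite Ez //; lia.
  case: (ltnP a 2) => [|a2]; first by case: a {am} => [|[|//]] _; rewrite ?E0 ?E1; lia.
  have jm : (a - 2) %/ 8 < m by lia.
  rewrite (_ : a = 8 * ((a - 2) %/ 8) + 2 + (a - 2) %% 8); last by lia.
  have k8 : (a - 2) %% 8 < 8 by rewrite ltn_mod.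
  rewrite EE // /block; have := Um _ jm; have := Vm _ jm; move: ((a - 2) %/ 8) jm k8.
  by move=> j jm; case: ((a - 2) %% 8) => [|[|[|[|[|[|[|[|//]]]]]]]] _ /=; lia.
have [R [R0 R1 R2 Rh r1]] :=
  pre_correct _ _ _ _ _ p _ _ C bW M0 M1 MU MV Mz E0 E1 EE Ez.
have [|s1 [r2 pc1 m1 lo1]] :=
    sim_run _ _ _ _ _ _ (Config 53 R E C) WW' _ rs hs.
  by split=> //=; rewrite min0n.
have [_ sW] : bounded W' s.
  by apply: run_bounded WW' _ rs; split=> //= _; lia.
have [|||||R' [M' [M'E r3]]] :=
    post_correct W' p m (regs s1) (memory s1) (coins s1) W16 => //.
- by lia.
- by rewrite m1.
- by rewrite lo1.
- by rewrite lo1.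
- by rewrite lo1.
exists (Config 52 R' M' (coins s1)); split.
- apply: reaches_halted; last by rewrite /halted fetch_main.
  (* The three budgets are those of preprocessing, simulation and postprocessing. *)
  rewrite (_ : t + 37 * m + 18 = (29 * m + 14) + (t.+1 + (8 * m + 3))); last lia.
  apply: reaches_trans r1 (reaches_trans _ _ _ _ _ _ _ r2 _).
  by case: s1 pc1 r3 {m1 lo1 r2 M'E} => pc1 ? ? ? /= ->.
- by rewrite /halted fetch_main.
- by move=> j jm /=; rewrite M'E ?m1.
Qed.

(** * Encodings and elementary facts on graphs *)

Lemma size_pairs (T : Type) (f g : T -> nat) (s : seq T) :
  size (flatten [seq [:: f e; g e] | e <- s]) = 2 * size s.
Proof. by elim: s => //= e s ->; rewrite mulnS. Qed.

Lemma nth_pairs (T : Type) (f g : T -> nat) (x0 : T) (s : seq T) k :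
  k < size s ->
  nth 0 (flatten [seq [:: f e; g e] | e <- s]) (2 * k) = f (nth x0 s k) /\
  nth 0 (flatten [seq [:: f e; g e] | e <- s]) (2 * k + 1) = g (nth x0 s k).
Proof.
elim: s k => //= e s IH [|k] // ks; have [h1 h2] := IH k ks.
by rewrite (_ : 2 * k.+1 = (2 * k).+2) //; lia.
Qed.

Lemma encode_edge (G : graph) (i : 'I_(nedges G)) :
  nth 0 (encode_graph G) (2 * i + 2) = val (tnth (edges G) i).1 /\
  nth 0 (encode_graph G) (2 * i + 2 + 1) = val (tnth (edges G) i).2.
Proof.
rewrite /encode_graph !addn2 addSn addn1 /= -[(2 * i).+1]addn1.
rewrite (tnth_nth (tnth (edges G) i)).
have := nth_pairs _ (fun e => val e.1) (fun e => val e.2) (tnth (edges G) i) (edges G) i.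
by rewrite size_tuple; apply.
Qed.

Lemma size_encode (G : graph) : size (encode_graph G) = 2 * nedges G + 2.
Proof. by rewrite /= size_pairs size_tuple addn2. Qed.

(** No vertex is isolated, so each occurs among the [2 * nedges G] ends of edges. *)
Lemma nverts_le (G : graph) : nverts G <= 2 * nedges G.
Proof.
pose s := [seq e.1 | e <- edges G] ++ [seq e.2 | e <- edges G].
rewrite (_ : 2 * _ = size s); last by rewrite size_cat !size_map size_tuple addnn mul2n.
rewrite -[X in X <= _]card_ord cardE; apply: uniq_leq_size; first exact: enum_uniq.
move=> u _; have [v] := @no_isolated G u; rewrite mem_cat /adj_of => /orP[] h.
- by apply/orP; left; apply/mapP; exists (u, v).
- by apply/orP; right; apply/mapP; exists (v, u).
Qed.

Lemma adj_ofC n m (es : m.-tuple ('I_n * 'I_n)) : symmetric (adj_of es).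
Proof. by move=> u v; rewrite /adj_of orbC. Qed.

Lemma edge_neq (G : graph) e : e \in edges G -> e.1 != e.2.
Proof.
move=> eG; apply/eqP => e12; have := edges_oriented eG.
by rewrite -e12 {2}e12 -surjective_pairing eG.
Qed.

(** * The gadget graph and its short cycles *)

Section Gadget.
Variable G : graph.
Local Notation n := (nverts G).
Local Notation m := (nedges G).
Local Notation U := ('I_(m + (n + n))).

(** The three kinds of vertices start at offsets 0, [m] and [m + n], matching the numbers that the
    machine writes. *)
Definition mid (i : 'I_m) : U := lshift _ i.
Definition ver (v : 'I_n) : U := rshift _ (lshift _ v).
Definition cop (v : 'I_n) : U := rshift _ (rshift _ v).

Lemma quot4_lt (k : 'I_(4 * m)) : k %/ 4 < m.
Proof. by have := ltn_ord k; lia. Qed.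

(** Every pair ends in a [ver] vertex and starts in one of another kind; this yields both the
    orientation condition and bipartiteness. *)
Definition gadget_block (i : 'I_m) : seq (U * U) :=
  let e := tnth (edges G) i in
  [:: (mid i, ver e.1); (mid i, ver e.2); (cop e.2, ver e.1); (cop e.1, ver e.2)].

Definition gadget_edge (k : 'I_(4 * m)) : U * U :=
  let i := Ordinal (quot4_lt k) in
  nth (mid i, mid i) (gadget_block i) (k %% 4).

Definition gadget_edges : (4 * m).-tuple (U * U) :=
  [tuple gadget_edge k | k < 4 * m].

Lemma gadget_tnth (i : 'I_m) j : j < 4 ->
  exists k : 'I_(4 * m), [/\ val k = 4 * i + j,
    tnth gadget_edges k \in gadget_edges &
    tnth gadget_edges k = nth (mid i, mid i) (gadget_block i) j].
Proof.
move=> j4; have kP : 4 * i + j < 4 * m by have := ltn_ord i; lia.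
exists (Ordinal kP); split => //; first exact: mem_tnth.
rewrite tnth_mktuple /gadget_edge /=.
have -> : Ordinal (quot4_lt (Ordinal kP)) = i.
  by apply/val_inj => /=; rewrite mulnC divnMDl // divn_small // addn0.
by rewrite mulnC modnMDl modn_small.
Qed.

Lemma gadget_edgeP a b : (a, b) \in gadget_edges ->
  exists2 v, b = ver v &
    (exists2 i, a = mid i & v \in [:: (tnth (edges G) i).1; (tnth (edges G) i).2]) \/
    (exists2 w, a = cop w & adj v w).
Proof.
move=> /mapP[k _]; rewrite /gadget_edge; set i := Ordinal _.
have eG := mem_tnth i (edges G); rewrite /adj /adj_of.
have : k %% 4 < 4 by rewrite ltn_mod.
rewrite /gadget_block; case: (k %% 4) => [|[|[|[|//]]]] _ /= [-> ->]; eexists => //.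
- by left; exists i => //; rewrite inE eqxx.
- by left; exists i => //; rewrite !inE eqxx orbT.
- by right; eexists => //; rewrite -surjective_pairing eG.
- by right; eexists => //; rewrite -surjective_pairing eG orbT.
Qed.

Lemma mid_inj : injective mid. Proof. exact: lshift_inj. Qed.

Lemma ver_inj : injective ver.
Proof. by move=> u v /rshift_inj /lshift_inj. Qed.

Lemma cop_inj : injective cop.
Proof. by move=> u v /rshift_inj /rshift_inj. Qed.

Lemma mid_ver i v : mid i != ver v. Proof. by rewrite eq_lrshift. Qed.

Lemma cop_ver w v : cop w != ver v.
Proof. by rewrite eq_rshift eq_rlshift. Qed.

(** Stated on numeric values, like [edge_flip], so that [lia] can use it in [gadget_inj]. *)
Lemma edge_inj (i i' : 'I_m) :
  val (tnth (edges G) i).1 = val (tnth (edges G) i').1 ->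
  val (tnth (edges G) i).2 = val (tnth (edges G) i').2 -> val i = val i'.
Proof.
move=> /val_inj h1 /val_inj h2; congr val.
apply: (tuple_uniqP _ (edges_uniq G)).
by rewrite [LHS]surjective_pairing h1 h2 -surjective_pairing.
Qed.

Lemma edge_flip (i i' : 'I_m) :
  val (tnth (edges G) i).1 = val (tnth (edges G) i').2 ->
  val (tnth (edges G) i).2 = val (tnth (edges G) i').1 -> False.
Proof.
move=> /val_inj h1 /val_inj h2; have := edges_oriented (mem_tnth i' (edges G)).
by rewrite -h1 -h2 -surjective_pairing mem_tnth.
Qed.

(** A [mid] pair determines [i] and, the ends being distinct, its offset. Two equal [cop] pairs come
    from the same edge of [G] if their offsets agree, and from mutually reversed edges otherwise,
    which [edge_flip] forbids. *)
Lemma gadget_inj : injective gadget_edge.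
Proof.
move=> k k'; rewrite /gadget_edge; set i := Ordinal _; set i' := Ordinal _.
have kE := divn_eq k 4; have kE' := divn_eq k' 4.
have iE : nat_of_ord i = k %/ 4 by []; have iE' : nat_of_ord i' = k' %/ 4 by [].
have lt_i := ltn_ord i; have lt_i' := ltn_ord i'.
have P1 : val i = val i' -> val (tnth (edges G) i).1 = val (tnth (edges G) i').1 /\
    val (tnth (edges G) i).2 = val (tnth (edges G) i').2 by move=> /val_inj ->.
have P2 := edge_inj i i'.
have P3 := edge_flip i i'.
have P4 : val (tnth (edges G) i).1 <> val (tnth (edges G) i).2.
  by apply/eqP; apply/edge_neq/mem_tnth.
have P5 : val (tnth (edges G) i').1 <> val (tnth (edges G) i').2.
  by apply/eqP; apply/edge_neq/mem_tnth.
move: (ltn_pmod k (isT : 0 < 4)) (ltn_pmod k' (isT : 0 < 4)).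
rewrite /gadget_block => k4 k4' h; apply/val_inj; move: k4 k4' kE kE' h.
rewrite /mid /ver /cop.
move: {i i'} (i) (i') iE iE' lt_i lt_i' P1 P2 P3 P4 P5 => i i' iE iE' lt_i lt_i'.
move: (tnth (edges G) i) (tnth (edges G) i') => [a b] [a' b'] /= P1 P2 P3 P4 P5.
(* Sixteen pairs of offsets, each a problem of linear arithmetic on vertex numbers. *)
case: (k %% 4) => [|[|[|[|//]]]] _; case: (k' %% 4) => [|[|[|[|//]]]] _ /= kE kE'.
all: case=> h1 h2; lia.
Qed.

Lemma gadget_uniq : uniq gadget_edges.
Proof. by rewrite map_inj_uniq ?enum_uniq //; apply: gadget_inj. Qed.

Lemma gadget_oriented e : e \in gadget_edges -> (e.2, e.1) \notin gadget_edges.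
Proof.
case: e => a b /gadget_edgeP[v ->] /= h; apply/negP => /gadget_edgeP[u aE _].
by case: h => [[i]|[w]]; rewrite aE => /eqP; rewrite eq_sym;
  rewrite ?(negbTE (mid_ver _ _)) ?(negbTE (cop_ver _ _)).
Qed.

Lemma gadget_mid_edge i v : v \in [:: (tnth (edges G) i).1; (tnth (edges G) i).2] ->
  (mid i, ver v) \in gadget_edges.
Proof.
rewrite !inE => /orP[/eqP ->|/eqP ->].
- by have [//|k [_ h]] := gadget_tnth i 0; rewrite /= => <-.
- by have [//|k [_ h]] := gadget_tnth i 1; rewrite /= => <-.
Qed.

Lemma gadget_cop_edge w v : adj w v -> (cop w, ver v) \in gadget_edges.
Proof.
rewrite /adj /adj_of => /orP[] /tnthP[i e].
- by have [//|k [_ h]] := gadget_tnth i 3; rewrite /= -e /= => <-.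
- by have [//|k [_ h]] := gadget_tnth i 2; rewrite /= -e /= => <-.
Qed.

Lemma gadget_no_isolated a : exists b, adj_of gadget_edges a b.
Proof.
rewrite /adj_of; case: (split_ordP a) => [i ->|j ->].
  exists (ver (tnth (edges G) i).1).
  by rewrite gadget_mid_edge // inE eqxx.
case: (split_ordP j) => [v ->|w ->].
- have [u vu] := @no_isolated G v; exists (cop u).
  by rewrite gadget_cop_edge ?orbT // /adj adj_ofC.
- have [u wu] := @no_isolated G w; exists (ver u).
  by rewrite gadget_cop_edge.
Qed.

Definition gadget : graph := Graph gadget_uniq gadget_oriented gadget_no_isolated.

Lemma gadget_adj_ver v a : adj (ver v : 'I_(nverts gadget)) a ->
  (exists2 i, a = mid i & v \in [:: (tnth (edges G) i).1; (tnth (edges G) i).2]) \/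
  (exists2 w, a = cop w & adj v w).
Proof.
rewrite {1}/adj /adj_of => /orP[] /gadget_edgeP [u].
  move=> _ [[i]|[w]] /eqP; rewrite eq_sym ?(negbTE (mid_ver _ _)) ?(negbTE (cop_ver _ _)) //.
move/ver_inj => <- [h|[w ? h]]; [by left|by right; exists w; rewrite // /adj adj_ofC].
Qed.

Lemma gadget_adj_mid i a : adj (mid i : 'I_(nverts gadget)) a ->
  exists2 v, a = ver v & v \in [:: (tnth (edges G) i).1; (tnth (edges G) i).2].
Proof.
rewrite /adj /adj_of => /orP[] /gadget_edgeP [u].
  move=> -> [[j /mid_inj <-]|[w /eqP]]; first by exists u.
  by rewrite eq_lrshift.
by move/eqP; rewrite (negbTE (mid_ver _ _)).
Qed.

Definition is_ver (a : U) : bool := [exists v, a == ver v].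

Lemma gadget_bipartite (a b : 'I_(nverts gadget)) : adj a b -> is_ver a = ~~ is_ver b.
Proof.
have nmid i : is_ver (mid i) = false.
  by apply/existsP => -[v]; rewrite (negbTE (mid_ver _ _)).
have ncop i : is_ver (cop i) = false.
  by apply/existsP => -[v]; rewrite (negbTE (cop_ver _ _)).
have yver v : is_ver (ver v) by apply/existsP; exists v.
by rewrite /adj /adj_of => /orP[] /gadget_edgeP [u ->] [[i ->]|[w ->]] *;
  rewrite ?nmid ?ncop yver.
Qed.

Lemma triangle_cycle i : in_triangle (tnth (edges G) i) ->
  exists2 c, simple_cycle_through (mid i : 'I_(nverts gadget)) c & size c = 4.
Proof.
move=> /existsP[w /andP[w1 w2]]; set e := tnth (edges G) i in w1 w2.
exists [:: mid i; ver e.1; cop w; ver e.2] => //; split=> //; last exact: mem_head.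
have mv v : v \in [:: e.1; e.2] -> adj (mid i : 'I_(nverts gadget)) (ver v).
  by move=> ve; rewrite /adj /adj_of gadget_mid_edge.
have cv v : adj v w -> adj (cop w : 'I_(nverts gadget)) (ver v).
  by move=> vw; rewrite /adj /adj_of gadget_cop_edge // /adj adj_ofC.
apply/andP; split.
  rewrite /= mv ?inE ?eqxx // cv //.
  rewrite /adj adj_ofC; rewrite -/(adj (G := gadget) _ _) cv //=.
  by rewrite /adj adj_ofC -/(adj (G := gadget) _ _) mv // !inE eqxx orbT.
have e12 : e.1 != e.2 by apply/edge_neq/mem_tnth.
rewrite /= !inE !negb_or !mid_ver [ver e.1 == _]eq_sym !cop_ver (inj_eq ver_inj) e12.
by rewrite /mid /cop eq_lrshift.
Qed.

(** Bipartiteness excludes lengths 3 and 5. In a 4-cycle the neighbours of [mid i] are the two ends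
    of the edge, so the opposite vertex is a second midpoint of that edge, which is impossible, or a
    copy of a common neighbour. *)
Lemma no_triangle_cycle i c : ~~ in_triangle (tnth (edges G) i) ->
  simple_cycle_through (mid i : 'I_(nverts gadget)) c -> 6 <= size c.
Proof.
move=> nt [/andP[cyc un] c3 ic].
(* The cycle is rotated to start at [mid i]. *)
have [k s rs] := rot_to ic.
rewrite -(size_rot k) rs; rewrite -(rot_cycle k) rs in cyc.
rewrite -(rot_uniq k) rs in un; rewrite -(size_rot k) rs in c3.
case: s {rs} cyc un c3 => [|a [|b [|d [|f [|? ?]]]]] //= cyc un _.
- case/and4P: cyc => /gadget_bipartite h1 /gadget_bipartite h2 /gadget_bipartite h3 _.
  by move: h1 h2 h3; case: (is_ver _); case: (is_ver _); case: (is_ver _).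
- case/and5P: cyc => ha hb hd hi _.
  have [u au ue] := gadget_adj_mid _ _ ha.
  move: hi; rewrite /adj adj_ofC -/(adj (G := gadget) _ _) => hi.
  have [v dv ve] := gadget_adj_mid _ _ hi.
  subst a d; move: hd; rewrite /adj adj_ofC -/(adj (G := gadget) _ _) => hd.
  have uv : u != v.
    move: un; rewrite !inE !negb_or => /and4P[_ /andP[_ h] _ _].
    by rewrite -(inj_eq ver_inj).
  have [[j bj uj]|[w bw uw]] := gadget_adj_ver _ _ hb.
    have [[j' bj' vj]|[w bw vw]] := gadget_adj_ver _ _ hd; last first.
      by move/eqP: bw; rewrite bj eq_lrshift.
    have jj : j' = j by apply: mid_inj; rewrite -bj.
    have ij : val i <> val j.
      move/val_inj => ij; move: un; rewrite bj ij.
      by rewrite /= !inE eqxx !orbT.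
    (* The opposite vertex is [mid j]: edges [i] and [j] then have the same two ends, in the same or
       the reverse order. *)
    have P2 := edge_inj i j; have P3 := edge_flip i j.
    move: ue ve uj vj uv; rewrite jj !inE => ue ve uj vj uv; exfalso.
    by move: ue ve uj vj uv => /orP[] /eqP ? /orP[] /eqP ? /orP[] /eqP ? /orP[] /eqP ? /eqP ?;
      first [congruence | apply: ij; apply: P2; congruence | apply: P3; congruence].
  have [[j bj vj]|[w' bw' vw]] := gadget_adj_ver _ _ hd.
    by move/eqP: bj; rewrite bw eq_sym eq_lrshift.
  have ww : w' = w by apply: cop_inj; rewrite -bw.
  rewrite ww in vw; case/negP: nt; apply/existsP; exists w.
  by move: ue ve uv; rewrite !inE => /orP[] /eqP <- /orP[] /eqP <-; rewrite ?eqxx ?uw ?vw.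
- case/and5P: cyc => /gadget_bipartite h1 /gadget_bipartite h2 /gadget_bipartite h3
    /gadget_bipartite h4 /andP[/gadget_bipartite h5 _].
  by move: h1 h2 h3 h4 h5; do 5!case: (is_ver _).
Qed.

End Gadget.

(** * From estimates to triangles *)

Lemma SC_le (R : realType) (G : graph) (v : 'I_(nverts G)) c :
  simple_cycle_through v c -> (SC R v <= (size c)%:R%:E)%E.
Proof. by move=> vc; apply: ereal_inf_lbound; exists c. Qed.

Lemma le_SC (R : realType) (G : graph) (v : 'I_(nverts G)) k :
  (forall c, simple_cycle_through v c -> k <= size c) -> (k%:R%:E <= SC R v)%E.
Proof.
by move=> h; apply: le_ereal_inf_tmp => _ [c vc <-]; rewrite lee_fin ler_nat h.
Qed.

Lemma le_estimate (R : realType) k w :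
  (k%:R%:E <= estimate R w)%E = (w == 0) || (k <= w).
Proof. by rewrite /estimate; case: eqP => _; rewrite ?leey // lee_fin ler_nat. Qed.

(** With a triangle the estimate is finite and below [3 / 2 * 4 = 6]; without one it is at least 6
    or infinite, the latter encoded by 0. *)
Lemma estimate_triangle (R : realType) (alpha : R) (G : graph) (i : 'I_(nedges G)) w :
  (alpha < 3 / 2)%R ->
  (SC R (mid G i : 'I_(nverts (gadget G))) <= estimate R w <=
    alpha%:E * SC R (mid G i : 'I_(nverts (gadget G))))%E ->
  (0 < w < 6) = in_triangle (tnth (edges G) i).
Proof.
move=> a32 /andP[lo hi]; case: (boolP (in_triangle _)) => tri; last first.
  have := le_trans (le_SC R _ _ 6 (fun c => no_triangle_cycle G i c tri)) lo.
  by rewrite le_estimate; lia.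
have [c cP c4] := triangle_cycle G i tri.
have := SC_le R _ _ _ cP; rewrite c4.
(* Nonnegativity rules out the value [-oo] and handles nonpositive [alpha] below. *)
have := le_SC R _ _ 0 (fun c _ => leq0n (size c)) :
  (_ <= SC R (mid G i : 'I_(nverts (gadget G))))%E.
move: lo hi; case: (SC R _) => [r _|//|//]; rewrite !lee_fin => hi r0 r4.
have : (estimate R w < 6%:R%:E)%E.
  apply: le_lt_trans hi _; rewrite -EFinM lte_fin.
  have [a0|a0] := lerP alpha 0%R.
    by apply: le_lt_trans (mulr_le0_ge0 a0 r0) _; rewrite ltr0n.
  by apply: le_lt_trans (ler_wpM2l (ltW a0) r4) _; lra.
by rewrite ltNge le_estimate; lia.
Qed.

(** Word [k] of a block belongs to its edge [k %/ 2], with parity selecting the end; this ties the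
    gadget to the machine's [block]. *)
Lemma encode_gadget (G : graph) (i : 'I_(nedges G)) k : k < 8 ->
  let e := tnth (edges G) i in let m := nedges G in let n := nverts G in
  nth 0 (encode_graph (gadget G)) (8 * i + 2 + k) =
  nth 0 [:: val i; m + e.1; val i; m + e.2;
            m + n + e.2; m + e.1; m + n + e.1; m + e.2] k.
Proof.
move=> k8 /=; have [|k' [k'E _ eE]] := gadget_tnth G i (k %/ 2); first lia.
have [h1 h2] := encode_edge (gadget G) k'.
have kE := divn_eq k 2.
have aE : 8 * i + 2 + k = 2 * k' + 2 + k %% 2 by rewrite -[nat_of_ord k']/(val k') k'E; lia.
rewrite aE; have : k %% 2 < 2 by rewrite ltn_mod.
case: (k %% 2) kE {aE} => [|[|//]] kE _; rewrite ?addn0 ?h1 ?h2 eE kE.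
all: case: (k %/ 2) kE k8 => [|[|[|[|q]]]] kE k8 /=; rewrite ?addnA //; lia.
Qed.

(** * Running times *)

Lemma time_OP (R : realType) (t : nat -> nat) (a : R) :
  time_O t a <->
  exists (c : R) (N : nat), forall m, N <= m -> ((t m)%:R <= c * m%:R `^ a)%R.
Proof.
have nrm m : (`|m%:R `^ a : R^o| = m%:R `^ a)%R by rewrite ger0_norm // powR_ge0.
rewrite /time_O eqO_exP; split.
  case=> c [_ [N _ H]]; exists c, N => m /H /=.
  by rewrite nrm normr_nat.
case=> c [N H]; exists (`|c| + 1)%R; first by have := normr_ge0 c; lra.
exists N => // m /H h /=; rewrite nrm normr_nat; apply: le_trans h _.
by apply: ler_wpM2r; [exact: powR_ge0|rewrite ler_wpDr // ler_norm].
Qed.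

Lemma time_O_reduction (R : realType) (t : nat -> nat) (a b : R) :
  (a <= b)%R -> (1 <= b)%R -> time_O t a ->
  time_O (fun m => t (4 * m) + 37 * m + 18) b.
Proof.
move=> ab b1 /time_OP[c [N H]]; apply/time_OP.
(* The first term pays for [t (4 * m)], and [55 = 37 + 18] for the overhead, as [m >= 1] and
   [b >= 1]. *)
exists (`|c| * 4 `^ a + 55)%R, N.+1 => m Nm.
have m1 : (1 <= m%:R :> R)%R by rewrite ler1n; lia.
have h1 : ((t (4 * m))%:R <= `|c| * 4 `^ a * m%:R `^ b :> R)%R.
  apply: le_trans (H _ _) _; first by lia.
  rewrite natrM powRM ?ler0n // -mulrA.
  apply: le_trans (ler_wpM2r _ (ler_norm c)) _.
    by rewrite mulr_ge0 ?powR_ge0.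
  rewrite ler_wpM2l // ler_wpM2l ?powR_ge0 //.
  exact: ler_powR.
have h2 : (m%:R <= m%:R `^ b :> R)%R.
  by rewrite -[X in (X <= _)%R]powRr1 ?ler0n //; apply: ler_powR.
have -> : ((t (4 * m)%N + 37 * m + 18)%:R = (t (4 * m)%N)%:R + 37 * m%:R + 18 :> R)%R.
  by rewrite natrD natrD (natrM _ 37).
nra.
Qed.

(** * The reduction *)

Lemma reduction_correct (R : realType) (alpha : R) (G : graph) p c t tape :
  (alpha < 3 / 2)%R ->
  @succeeds (approx_ANSC alpha) p c t (gadget G) tape ->
  @succeeds AE_Sparse_Triangle (wrap p) (2 * c + 2) (t + 37 * nedges G + 18) G tape.
Proof.
set m := nedges G; set n := nverts G => a32 [s [rs hs sP]].
have szE : size (encode_graph (gadget G)) = 8 * m + 2 by rewrite size_encode mulnA.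
(* The gadget's word bound is [(8 * m + 4) ^ c], and [(2 * m + 4) ^ 2] exceeds its base. Doubling
   [c] thus covers the simulation; the added 2 makes room for the wrapper's own values even when
   [c = 0]. *)
have [B16 BM] : 16 <= (2 * m + 4) ^ 2 /\ 8 * m + 10 <= (2 * m + 4) ^ 2.
  by rewrite /expn /=; nia.
have BW : (2 * m + 4) ^ 2 <= word_bound (2 * c + 2) (encode_graph G).
  rewrite /word_bound size_encode -addnA leq_pexp2l //; lia.
have WW : word_bound c (encode_graph (gadget G)) <=
          word_bound (2 * c + 2) (encode_graph G).
  rewrite /word_bound szE size_encode -/m (_ : 2 * c + 2 = 2 * c.+1); last by lia.
  rewrite expnM -[2 * m + 2 + 2]addnA -[8 * m + 2 + 2]addnA.
  apply: leq_trans (leq_pexp2l _ (leqnSn c)); last by rewrite expn_gt0 addn_gt0 orbT.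
  case: (c) => [|c']; first by rewrite !expn0.
  by rewrite leq_exp2r //; apply: leq_trans BM; rewrite leq_add2l.
(* The ends of the edges as functions on all naturals, with 0 as default beyond the last edge. *)
pose f := fun j => if insub j is Some i then nat_of_ord (tnth (edges G) i).1 else 0.
pose g := fun j => if insub j is Some i then nat_of_ord (tnth (edges G) i).2 else 0.
have fE (i : 'I_m) : f i = (tnth (edges G) i).1 by rewrite /f valK.
have gE (i : 'I_m) : g i = (tnth (edges G) i).2 by rewrite /g valK.
have [|j jm|j jm|a am|||j k jm k8|a am|s' [rs' hs' s'E]] :=
    wrap_correct (word_bound c (encode_graph (gadget G))) _ n m f g p
      (nth 0 (encode_graph (gadget G))) (nth 0 (encode_graph G)) tape t s
      _ erefl erefl _ _ _ _ _ _ _ WW rs hs.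
- split; [exact: leq_trans BW|exact: leq_trans BW|exact: nverts_le| |] => j jm.
  + by rewrite -[j]/(val (Ordinal jm)) fE.
  + by rewrite -[j]/(val (Ordinal jm)) gE.
- by rewrite -[j]/(val (Ordinal jm)) fE; have [] := encode_edge G (Ordinal jm).
- by rewrite -[j]/(val (Ordinal jm)) gE; have [] := encode_edge G (Ordinal jm).
- by rewrite nth_default // size_encode -/m; lia.
- by rewrite /= addnA.
- by [].
- by rewrite -[j]/(val (Ordinal jm)) encode_gadget // /block fE gE.
- by rewrite nth_default // szE.
exists s'; split=> // i; rewrite s'E //.
by rewrite -(estimate_triangle R alpha G i (memory s i) a32).
Qed.

Theorem theorem12 (R : realType) (k : mode) :
  AE_Sparse_Triangle_Hypothesis R k ->
  forall alpha : R, (alpha < 3 / 2)%R ->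
  requires_time k (approx_ANSC alpha) (4 / 3 : R)%R.
Proof.
move=> hyp alpha a32 eps t eps0 [p [c sol]] tO; apply: hyp.
(* Capping at [1 / 3] keeps the exponent at least 1, so that the linear overhead is absorbed. *)
exists (Num.min eps (1 / 3))%R, (fun m => t (4 * m) + 37 * m + 18); split.
- by rewrite lt_min eps0 /=; lra.
- exists (wrap p), (2 * c + 2) => G.
  case: k sol => sol; first exact: (reduction_correct R _ _ _ _ _ _ a32 (sol (gadget G))).
  (* The wrapper flips no coins of its own, so every tape on which [p] succeeds serves unchanged and
     the success probability does not drop. *)
  have [L good] := sol (gadget G); exists L; apply: leq_trans good _.
  rewrite leq_mul2l /=; apply: subset_leq_card; apply/fintype.subsetP => w.
  rewrite !inE => ok.
  exact: (reduction_correct R _ _ _ _ _ _ a32 ok).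
- apply: time_O_reduction tO.
  + by rewrite lerD2l lerN2 ge_min lexx.
  + have : (Num.min eps (1 / 3) <= 1 / 3 :> R)%R by rewrite ge_min lexx orbT.
    by lra.
Qed.
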